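(* Let $(\Gamma,\mathcal{G}_\Gamma)$ and $(\Sigma,\mathcal{G}_\Sigma)$ be labeled graphs whose vertex groups are all primary cyclic groups, and let $\tau:W(\Gamma)\to W(\Sigma)$ be a group isomorphism. Then there exists a labeled-graph isomorphism $t:(\Gamma,\mathcal{G}_\Gamma)\to(\Sigma,\mathcal{G}_\Sigma)$ such that $t(u)\in\mathrm{csupp}(\tau(u))$ for every $u\in V_\Gamma$.
   Context: A labeled graph $(\Lambda,\mathcal{G}_\Lambda)$ consists of a nonempty finite simplicial graph $\Lambda$ with vertex set $V_\Lambda$ and a family $\mathcal{G}_\Lambda=\{G_v\}_{v\in V_\Lambda}$ of nontrivial groups. Its graph product $W(\Lambda)$ is the quotient of the free product $\ast_{v}G_v$ by the relations $gh=hg$ for $g\in G_v$, $h\in G_{v'}$ with $v,v'$ adjacent. A labeled-graph isomorphism $(\Gamma,\mathcal{G}_\Gamma)\to(\Sigma,\mathcal{G}_\Sigma)$ is a bijection $f:V_\Gamma\to V_\Sigma$ with $u,v$ adjacent iff $f(u),f(v)$ adjacent, and $G_u\cong G_{f(u)}$ for all $u$. A cyclic group is primary if it has prime-power order. For cyclic vertex groups, a generator of each $G_v$ is fixed and also denoted $v$; a word in $V_\Lambda^{\pm1}$ is reduced if no shorter word represents the same element; $\mathrm{supp}(g)$ is the set of vertices $v$ such that $v$ or $v^{-1}$ appears in some reduced word representing $g$; and $\mathrm{csupp}(g):=\{v\in V_\Lambda:\ v\in\mathrm{supp}(wgw^{-1})\text{ for all }w\in W(\Lambda)\}$. *)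

(* Defs.v *)
(* Graph products of primary cyclic groups, encoded by words
   over the alphabet V^{+-1} modulo the defining relations (setoid encoding). *)
From mathcomp Require Import all_boot.
Set Implicit Arguments. Unset Strict Implicit. Unset Printing Implicit Defensive.

(* A cyclic group is primary: it has prime-power order p^k, k >= 1
   (k >= 1 because vertex groups are nontrivial). *)
Definition primary_order (n : nat) : Prop :=
  exists p k, prime p /\ 0 < k /\ n = p ^ k.

Section Words.
Variable V : finType.

(* A letter (v, true) is the generator v, (v, false) is v^{-1}. *)
Definition word := seq (V * bool).

Definition winv (w : word) : word := rev (map (fun x => (x.1, ~~ x.2)) w).

(* e : adjacency relation of the graph; o v : order of the cyclic group G_v. *)
Variables (e : rel V) (o : V -> nat).

Inductive wrel : word -> word -> Prop :=
  | wrel_inv (x : V) (b : bool) : wrel [:: (x, b); (x, ~~ b)] [::]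
  | wrel_ord (x : V) : wrel (nseq (o x) (x, true)) [::]
  | wrel_comm (x y : V) (b c : bool) :
      e x y -> wrel [:: (x, b); (y, c)] [:: (y, c); (x, b)].

Inductive weq : word -> word -> Prop :=
  | weq_step (l a b r : word) : wrel a b -> weq (l ++ a ++ r) (l ++ b ++ r)
  | weq_refl (w : word) : weq w w
  | weq_sym (w1 w2 : word) : weq w1 w2 -> weq w2 w1
  | weq_trans (w1 w2 w3 : word) : weq w1 w2 -> weq w2 w3 -> weq w1 w3.

Definition reduced (w : word) : Prop :=
  forall w' : word, weq w' w -> size w <= size w'.

Definition supp (w : word) (v : V) : Prop :=
  exists w' : word, [/\ weq w' w, reduced w' & v \in map fst w'].

Definition csupp (w : word) (v : V) : Prop :=
  forall x : word, supp (x ++ w ++ winv x) v.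

End Words.

Definition graph_product_iso (V1 V2 : finType) (e1 : rel V1) (o1 : V1 -> nat)
    (e2 : rel V2) (o2 : V2 -> nat) (f : word V1 -> word V2) : Prop :=
  [/\ forall a b, weq e1 o1 a b -> weq e2 o2 (f a) (f b),
      forall a b, weq e2 o2 (f (a ++ b)) (f a ++ f b)
    & exists g : word V2 -> word V1,
        [/\ forall a b, weq e2 o2 a b -> weq e1 o1 (g a) (g b),
            forall a, weq e1 o1 (g (f a)) a
          & forall b, weq e2 o2 (f (g b)) b]].

Definition primary_labeled_graph (V : finType) (e : rel V) (o : V -> nat) : Prop :=
  [/\ 0 < #|V|, irreflexive e, symmetric e & forall v, primary_order (o v)].

(* Labeled-graph isomorphism (cyclic groups are isomorphic iff same order). *)
Definition labeled_graph_iso (V1 V2 : finType) (e1 : rel V1) (o1 : V1 -> nat)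
    (e2 : rel V2) (o2 : V2 -> nat) (t : V1 -> V2) : Prop :=
  [/\ bijective t, forall u v, e1 u v = e2 (t u) (t v) & forall u, o1 u = o2 (t u)].

(* Main.v *)
(* The abelianization of the graph product W is the direct product of the vertex
   groups, and a vertex v whose coordinate in the abelianization of w is nonzero
   lies in the conjugacy support of w. Let M be the matrix of the coordinates of
   the elements tau(u). For each prime power n = p^k, the block of M with rows
   and columns of order n is invertible modulo p, so that a nonzero term of its
   determinant gives a bijection t between the vertices of order n such that t(u)
   is in csupp(tau(u)). Now let u, u' be adjacent. If t(u), t(u') were not
   adjacent, then W would retract onto the free product of the vertex groups at
   t(u) and t(u'), where an element of finite order is conjugate into a factor
   and so has a zero coordinate; applied to the images of tau(u), tau(u') and
   tau(u u'), all of finite order, this contradicts the choice of t. So t is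
   injective and maps edges to edges. Since the inverse of tau yields a map with
   the same properties in the other direction, counting edges shows that t is an
   isomorphism of graphs. *)
Require Import Defs.
From Stdlib Require Import Classical.
From mathcomp Require Import all_boot all_order fingroup perm all_algebra zify.
Set Implicit Arguments. Unset Strict Implicit. Unset Printing Implicit Defensive.
Import GRing.Theory Num.Theory.

(** * The free product of two finite cyclic groups *)

Section FreeProduct.
Variable M : bool -> nat.
Hypothesis M_gt1 : forall c, 1 < M c.

(** A pair [(c, k)] stands for the [k]-th power of the generator of the factor [c]. The free product
    is not formed as a quotient; it is seen through its action on normal forms. *)
Definition syllables := seq (bool * nat).
Implicit Types (c : bool) (s x : syllables).

Definition head_neq c s := if s is y :: _ then y.1 != c else true.

Fixpoint normal_form s :=
  if s is y :: s' then [&& 0 < y.2, y.2 < M y.1, head_neq y.1 s' & normal_form s']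
  else true.

Definition syl_cons c r s := if r == 0 then s else (c, r) :: s.

(** Left multiplication by a power of one generator, computed on normal forms (van der Waerden's
    action). *)
Definition push c k s :=
  if s is y :: s' then
    if y.1 == c then syl_cons c ((k + y.2) %% M c) s'
    else syl_cons c (k %% M c) s
  else syl_cons c (k %% M c) s.

Definition act s x := foldr (fun y => push y.1 y.2) x s.

Let M_gt0 c : 0 < M c. Proof. exact: ltnW. Qed.

(** Allowing [j = 0] treats alike the normal forms that start in the factor [c] and those that do
    not. *)
Lemma normal_split c s : normal_form s ->
  exists j s', [/\ s = syl_cons c j s', j < M c, head_neq c s' & normal_form s'].
Proof.
case: s => [|[d k] s] /=; first by exists 0, [::].
case/and4P=> k_gt0 kM hd ns; have [<-|dc] := eqVneq d c.
  by exists k, s; split=> //; rewrite /syl_cons; case: k k_gt0 {kM}.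
by exists 0, ((d, k) :: s); split=> //=; apply/and4P.
Qed.

Lemma normal_cons c r s :
  r < M c -> head_neq c s -> normal_form s -> normal_form (syl_cons c r s).
Proof.
by rewrite /syl_cons; case: eqP => //= /eqP; rewrite -lt0n => -> -> -> ->.
Qed.

Lemma push_cons c k j s : j < M c -> head_neq c s ->
  push c k (syl_cons c j s) = syl_cons c ((k + j) %% M c) s.
Proof.
move=> jM hd; rewrite {1}/syl_cons; case: (eqVneq j 0) => [->|_] /=.
  by rewrite addn0; case: s hd => [|[d i] s] //= /negPf ->.
by rewrite eqxx.
Qed.

Lemma normal_push c k s : normal_form s -> normal_form (push c k s).
Proof.
case/(normal_split c) => j [s' [-> jM hd ns]].
by rewrite push_cons // normal_cons // ltn_mod.
Qed.

Lemma push_push c k l s : normal_form s ->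
  push c k (push c l s) = push c (k + l) s.
Proof.
case/(normal_split c) => j [s' [-> jM hd ns]].
by rewrite !push_cons ?ltn_mod // modnDmr addnA.
Qed.

Lemma push_dvd c k s : M c %| k -> normal_form s -> push c k s = s.
Proof.
move=> kM /(normal_split c) [j [s' [-> jM hd ns]]].
by rewrite push_cons // -modnDml (eqP kM) add0n modn_small.
Qed.

Lemma push_mod c k s : push c (k %% M c) s = push c k s.
Proof. by case: s => [|y s] /=; rewrite ?modnDml modn_mod. Qed.

Lemma act_cat s1 s2 x : act (s1 ++ s2) x = act s1 (act s2 x).
Proof. exact: foldr_cat. Qed.

Lemma normal_act s x : normal_form x -> normal_form (act s x).
Proof. by move=> nx; elim: s => //= y s; apply: normal_push. Qed.

Lemma act_syl_cons c r s x : normal_form x ->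
  act (syl_cons c r s) x = push c r (act s x).
Proof.
rewrite /syl_cons; case: eqP => [->|] // nx.
by rewrite push_dvd // normal_act.
Qed.

Lemma act_push c k s x : normal_form s -> normal_form x ->
  act (push c k s) x = push c k (act s x).
Proof.
move=> ns nx; case/(normal_split c): ns => j [s' [-> jM hd ns]].
rewrite push_cons // !act_syl_cons // push_mod push_push //.
exact: normal_act.
Qed.

Lemma act_act s x : normal_form x -> act (act s [::]) x = act s x.
Proof.
by move=> nx; elim: s => //= y s IH; rewrite act_push ?IH // normal_act.
Qed.

Lemma act_normal s : normal_form s -> act s [::] = s.
Proof.
elim: s => //= [[c k] s IH] /= /and4P[k_gt0 kM hd ns]; rewrite IH //.
have {1}-> : s = syl_cons c 0 s by [].
by rewrite push_cons // addn0 modn_small // /syl_cons -if_neg -lt0n k_gt0.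
Qed.

Definition weight c s := \sum_(y <- s | y.1 == c) y.2.

Lemma weight_cat c s1 s2 : weight c (s1 ++ s2) = weight c s1 + weight c s2.
Proof. exact: big_cat. Qed.

Lemma weight_cons c d k s : weight c ((d, k) :: s) = (d == c) * k + weight c s.
Proof. by rewrite /weight big_cons /=; case: eqP; rewrite ?mul1n. Qed.

Lemma weight_push c d k s :
  weight c (push d k s) = (d == c) * k + weight c s %[mod M c].
Proof.
have wcons r s' : weight c (syl_cons d r s') = (d == c) * r + weight c s'.
  by rewrite /syl_cons; case: eqP => [->|_]; rewrite ?muln0 ?weight_cons.
case: s => [|[b j] s] /=; last case: (eqVneq b d) => [->|_].
- by rewrite wcons; case: eqP => [->|//]; rewrite !mul1n modnDml.
- rewrite wcons weight_cons; case: eqP => [->|//].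
  by rewrite !mul1n addnA modnDml.
- by rewrite wcons; case: eqP => [->|//]; rewrite !mul1n modnDml.
Qed.

Lemma weight_act c s : weight c (act s [::]) = weight c s %[mod M c].
Proof.
elim: s => //= [[d k] s] IH.
by rewrite weight_push weight_cons -modnDmr IH modnDmr.
Qed.

Definition spow s n : syllables := flatten (nseq n s).

Lemma spow_catC s1 s2 n : spow (s1 ++ s2) n ++ s1 = s1 ++ spow (s2 ++ s1) n.
Proof. by elim: n => [|n IH]; rewrite ?cats0 //= /spow /= -!catA IH. Qed.

Lemma normal_cat_cons s c k s' : normal_form s -> normal_form ((c, k) :: s') ->
  (s != [::] -> (last (c, k) s).1 != c) -> normal_form (s ++ (c, k) :: s').
Proof.
move=> ns ns'; elim: s ns => [|[d j] s IH] //= /and4P[j_gt0 jM hd ns] lst.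
rewrite j_gt0 jM IH // ?andbT /=; last first.
  by case: s lst {IH hd ns} => //= y s; apply.
by case: s hd lst {IH ns} => [|y s] //= _; rewrite eq_sym; apply.
Qed.

Lemma normal_spow y s n : normal_form (y :: s) -> (last y s).1 != y.1 ->
  normal_form (spow (y :: s) n).
Proof.
case: y => c k ns lst; elim: n => [|[|n] IH] //.
  by rewrite /spow /= cats0.
by apply: (normal_cat_cons ns IH).
Qed.

Lemma pushK c k s : normal_form s ->
  push c (M c - k %% M c) (push c k s) = s.
Proof.
move=> ns; rewrite push_push // push_dvd //.
by rewrite /dvdn -modnDmr subnK ?modnn // ltnW // ltn_mod.
Qed.

(* Cyclic reduction: rotating the last syllable to the front shortens a normal
   form with equal end factors; with distinct end factors all powers stay in
   normal form, so they are nontrivial. *)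
Lemma torsion_weight s n : 0 < n ->
  (forall x, normal_form x -> act (spow s n) x = x) ->
  M true %| weight true s \/ M false %| weight false s.
Proof.
move=> n_gt0.
(* By [act_act] the word may be replaced by its normal form, whose weights agree modulo [M c]; [m]
   serves the induction on length. *)
suff H m s' : size s' <= m -> normal_form s' ->
    (forall x, normal_form x -> act (spow s' n) x = x) ->
    exists c, weight c s' = 0 %[mod M c].
  move=> tor; have [||c] := H _ (act s [::]) (leqnn _).
  - exact: normal_act.
  - move=> x nx; rewrite -[RHS]tor //.
    elim: n {n_gt0 tor H} => //= k IH; rewrite /spow /= !act_cat.
    by rewrite -/(spow _ _) IH act_act // normal_act.
  by rewrite weight_act mod0n => /eqP; case: c; [left | right].
elim: m s' => [|m IH] {}s.
  by rewrite leqn0 => /nilP -> _ _; exists true; rewrite /weight big_nil.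
case: s => [|[c k] s]; first by exists true; rewrite /weight big_nil.
case: (lastP s) => [|s' [d l]].
  move=> _ _ _; exists (~~ c); rewrite weight_cons /weight big_nil.
  by rewrite eq_sym; case: c.
rewrite [size _]/= size_rcons ltnS => sz ns tor.
have [dc|dc] := eqVneq d c; last first.
  (* The [n]-th power is a nonempty normal form, yet it would fix [[::]]. *)
  have := tor [::] isT; rewrite act_normal; first by case: (n) n_gt0.
  by apply: normal_spow => //=; rewrite last_rcons.
rewrite {d}dc in ns tor *.
have nk : normal_form ((c, k) :: s').
  move: ns; rewrite -rcons_cons; elim: ((c, k) :: s') => // y r IHr.
  rewrite rcons_cons /= => /and4P[-> -> hd /IHr ->]; rewrite andbT /=.
  by case: r hd {IHr}.
have ns' : normal_form s' by case/and4P: nk.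
have rot x : normal_form x ->
    act (push c (l + k) s') x = act ((c, l) :: (c, k) :: s') x.
  by move=> nx; rewrite act_push //= push_push // normal_act.
have rotn j x : normal_form x ->
    act (spow (push c (l + k) s') j) x = act (spow ((c, l) :: (c, k) :: s') j) x.
  move=> nx; elim: j => // j IHj; rewrite /spow /= !act_cat -!/(spow _ _).
  by rewrite IHj rot // normal_act.
have [||x nx|b] := IH (push c (l + k) s').
- have szc r : size (syl_cons c r s') <= m.
    by rewrite /syl_cons; case: ifP => _ //=; apply: ltnW.
  have hd : head_neq c s' by case/and4P: nk.
  by rewrite -[s' in push _ _ s']/(syl_cons c 0 s') push_cons.
- exact: normal_push.
(* The rotated word is the conjugate of the original one by its last syllable [(c, l)]; [z] is [x]
   with that syllable divided off on the left. *)
- pose z := push c (M c - l %% M c) x.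
  have nz : normal_form z by apply: normal_push.
  have <- : push c l z = x.
    by rewrite -[RHS](pushK c l nx) !push_push // addnC.
  rewrite rotn ?normal_push //.
  rewrite -[push c l z]/(act [:: (c, l)] z) -act_cat -cat1s spow_catC act_cat.
  by rewrite cats1 tor.
- rewrite weight_push => E; exists b; rewrite -{}E.
  rewrite weight_cons /weight -cats1 big_cat -/(weight b _) big_mkcond big_seq1.
  by rewrite /=; case: eqP; rewrite ?addn0 // !mul1n -addnA (addnC l) !addnA.
Qed.
End FreeProduct.

(** * Graph products and their abelianization *)

Section GraphProduct.
Variables (V : finType) (e : rel V) (o : V -> nat).
Local Notation "a ~ b" := (weq e o a b) (at level 70).
Implicit Types (a b w : word V) (v : V).

Lemma weq_ctx l r a b : a ~ b -> l ++ a ++ r ~ l ++ b ++ r.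
Proof.
elim=> [l' c d r' cd|w|w1 w2 _|w1 w2 w3 _ w12 _]; last exact: weq_trans.
- rewrite !catA -(catA _ c) -(catA _ d) -!(catA (l ++ l')) -!(catA _ r').
  exact: weq_step.
- exact: weq_refl.
- exact: weq_sym.
Qed.

Lemma weq_cat a a' b b' : a ~ a' -> b ~ b' -> a ++ b ~ a' ++ b'.
Proof.
move=> aa' bb'; apply: (weq_trans (w2 := a' ++ b)).
  exact: (weq_ctx [::] b).
by have := weq_ctx a' [::] bb'; rewrite !cats0.
Qed.

Lemma weq_letterV (x : V * bool) : [:: x; (x.1, ~~ x.2)] ~ [::].
Proof.
case: x => x b.
exact: (@weq_step _ _ _ [::] _ [::] [::] (wrel_inv _ _ x b)).
Qed.

Lemma weq_winvr w : w ++ winv w ~ [::].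
Proof.
elim: w => [|x w IH]; first exact: weq_refl.
rewrite /winv /= rev_cons -cats1 (catA w).
apply: weq_trans (weq_letterV x).
exact: (weq_ctx [:: x] [:: (x.1, ~~ x.2)] IH).
Qed.

Lemma weq_idem w : w ++ w ~ w -> w ~ [::].
Proof.
move=> ww; apply: weq_trans (weq_winvr w).
rewrite -[X in X ~ _]cats0.
apply: (weq_trans (w2 := w ++ (w ++ winv w))).
  by apply: weq_cat; [apply: weq_refl | apply/weq_sym/weq_winvr].
by rewrite catA; apply: weq_cat => //; apply: weq_refl.
Qed.

Definition wpow w n : word V := flatten (nseq n w).

Lemma weq_order v : wpow [:: (v, true)] (o v) ~ [::].
Proof.
have -> : wpow [:: (v, true)] (o v) = [::] ++ nseq (o v) (v, true) ++ [::].
  by rewrite cats0 /wpow; elim: (o v) => //= n ->.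
by rewrite -[X in _ ~ X]/([::] ++ [::] ++ [::]); apply/weq_step/wrel_ord.
Qed.

Lemma weq_wpow_nil w n m : wpow w n ~ [::] -> wpow w (n * m) ~ [::].
Proof.
move=> wn; rewrite mulnC; elim: m => [|m IH]; first exact: weq_refl.
rewrite mulSn /wpow nseqD flatten_cat.
exact: (weq_cat wn IH).
Qed.

Lemma weq_wpow_cat a b n : a ++ b ~ b ++ a ->
  wpow (a ++ b) n ~ wpow a n ++ wpow b n.
Proof.
move=> ab; have abn m : wpow a m ++ b ~ b ++ wpow a m.
  elim: m => [|m IH]; first by rewrite cats0; apply: weq_refl.
  rewrite /wpow /= -catA; apply: (weq_trans (w2 := a ++ (b ++ wpow a m))).
    by apply: weq_cat => //; apply: weq_refl.
  by rewrite !catA; apply: weq_cat => //; apply: weq_refl.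
elim: n => [|n IH]; first exact: weq_refl.
rewrite /wpow /= -/(wpow _ _).
apply: (weq_trans (w2 := (a ++ b) ++ (wpow a n ++ wpow b n))).
  by apply: weq_cat => //; apply: weq_refl.
rewrite -!catA; apply: weq_cat; first exact: weq_refl.
rewrite !catA; apply: weq_cat; last exact: weq_refl.
exact/weq_sym/abn.
Qed.

Local Open Scope ring_scope.

Definition sgnb (b : bool) : int := if b then 1 else -1.

(* The [v]-coordinate, to be read modulo [o v], of the image of [w] in the
   abelianization, which is the direct product of the vertex groups. *)
Definition expsum v w : int := \sum_(x <- w | x.1 == v) sgnb x.2.

Lemma expsum_cat v a b : expsum v (a ++ b) = expsum v a + expsum v b.
Proof. exact: big_cat. Qed.

Lemma expsum_cons v x w :
  expsum v (x :: w) = (if x.1 == v then sgnb x.2 else 0) + expsum v w.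
Proof. by rewrite /expsum big_cons; case: eqP; rewrite ?add0r. Qed.

Lemma expsum1 v u : expsum v [:: (u, true)] = (u == v)%:R.
Proof. by rewrite expsum_cons /expsum big_nil addr0 /=; case: eqP. Qed.

Lemma expsum_nseq v u n : expsum v (nseq n (u, true)) = (u == v)%:R * n%:Z.
Proof.
elim: n => [|n IH]; first by rewrite /expsum big_nil mulr0.
by rewrite /= expsum_cons IH /=; case: eqP; lia.
Qed.

Lemma expsum_weq v a b : a ~ b -> (expsum v a = expsum v b %[mod o v])%Z.
Proof.
elim=> [l c d r cd|w|w1 w2 _|w1 w2 w3 _ w12 _] //; last by move=> <-.
rewrite !expsum_cat; apply/eqP; rewrite eqz_mod_dvd.
rewrite opprD addrACA subrr add0r opprD addrACA subrr addr0.
case: cd => [x b0|x|x y b0 c0 _]; rewrite ?expsum_cons /=.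
- by case: eqP b0 => [_ []|_ _]; rewrite /expsum !big_nil.
- rewrite expsum_nseq /expsum big_nil subr0.
  by case: eqP => [->|_]; rewrite ?mul1r ?mul0r.
- by rewrite addrCA subrr.
Qed.

(** Conjugation preserves the coordinate modulo [o v], and a word without the letter [v] or its
    inverse has coordinate 0. *)
Lemma csupp_expsum v w : ~~ (o v %| expsum v w)%Z -> csupp e o w v.
Proof.
move=> nz x; set y := x ++ _.
(* A reduced representative exists by descent on length. *)
have [w' [yw' rw']] : exists w', y ~ w' /\ reduced e o w'.
  have [n] := ubnP (size y); elim: n y => // n IH y; rewrite ltnS => yn.
  case: (classic (reduced e o y)) => [ry|nr].
    by exists y; split=> //; apply: weq_refl.
  have [z nrz] := not_all_ex_not _ _ nr.
  have [zy /negP] := imply_to_and _ _ nrz.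
  rewrite -ltnNge => zs.
  have [w' [zw' rw']] := IH z (leq_trans zs yn).
  by exists w'; split=> //; apply: weq_trans zw'; apply: weq_sym.
exists w'; split=> //; first exact: weq_sym.
apply: contraR nz => vw'.
have : (expsum v w' = 0).
  rewrite /expsum big1_seq // => z /andP[/eqP zv zw'].
  by case/negP: vw'; rewrite -zv map_f.
have := expsum_weq v yw'; rewrite /y !expsum_cat => E E0; rewrite E0 in E.
have := expsum_weq v (weq_winvr x); rewrite expsum_cat => E1.
have -> : expsum v w = (expsum v x + (expsum v w + expsum v (winv x)))
   - (expsum v x + expsum v (winv x)) by lia.
move/eqP: E; move/eqP: E1; rewrite !eqz_mod_dvd /expsum big_nil !subr0 => *.
exact: rpredB.
Qed.

(** * Homomorphisms to the integers modulo [n], given by integer lifts *)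

Section Characters.
Variables (n : nat) (phi : word V -> int).
Hypothesis phi_weq : forall a b, a ~ b -> (phi a = phi b %[mod n])%Z.
Hypothesis phiM : forall a b, (phi (a ++ b) = phi a + phi b %[mod n])%Z.

Lemma modhom_nil : (n %| phi [::])%Z.
Proof.
have /eqP := phiM [::] [::]; rewrite eqz_mod_dvd /= => H.
by rewrite -rpredN; have -> : - phi [::] = phi [::] - (phi [::] + phi [::]) by lia.
Qed.

Lemma modhom_letter v (b : bool) :
  (n %| phi [:: (v, b)] - sgnb b * phi [:: (v, true)])%Z.
Proof.
case: b; first by rewrite mul1r subrr.
have /eqP := phiM [:: (v, true)] [:: (v, false)]; rewrite eqz_mod_dvd /=.
have /eqP := phi_weq (weq_letterV (v, true)); rewrite eqz_mod_dvd /=.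
move: modhom_nil; set x := phi _; set t := phi [:: _; _].
set z := phi [:: (v, true)]; set y := phi _ => H1 H2 H3.
have -> : y - sgnb false * z = x + (t - x) - (t - (z + y)) by rewrite /=; lia.
exact: (rpredB (rpredD H1 H2) H3).
Qed.

(** A homomorphism to an abelian group factors through the abelianization, so its values on
    generators determine it. *)
Lemma modhom_expsum w :
  (n %| phi w - \sum_v expsum v w * phi [:: (v, true)])%Z.
Proof.
elim: w => [|[u b] w IH].
  rewrite big1 ?subr0 ?modhom_nil // => v _.
  by rewrite /expsum big_nil mul0r.
have /eqP := phiM [:: (u, b)] w; rewrite eqz_mod_dvd /=.
have := modhom_letter u b; move: IH.
have -> : \sum_v expsum v ((u, b) :: w) * phi [:: (v, true)] =
    sgnb b * phi [:: (u, true)] + \sum_v expsum v w * phi [:: (v, true)].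
  under eq_bigr do rewrite expsum_cons mulrDl.
  rewrite big_split /=; congr (_ + _).
  rewrite (bigD1 u) //= eqxx big1 ?addr0 // => v vu.
  by rewrite eq_sym (negPf vu) mul0r.
move=> H1 H2 H3.
have := rpredD (rpredD H1 H2) H3.
by congr (_ %| _)%Z; lia.
Qed.

Lemma modhom_wpow w k : (n %| phi (wpow w k) - k%:Z * phi w)%Z.
Proof.
elim: k => [|k IH]; first by rewrite mul0r subr0 modhom_nil.
have /eqP := phiM w (wpow w k); rewrite eqz_mod_dvd => H.
have := rpredD H IH; congr (_ %| _)%Z; rewrite /wpow /=; lia.
Qed.

Lemma modhom_torsion w k : wpow w k ~ [::] -> (n %| k%:Z * phi w)%Z.
Proof.
move=> /phi_weq/eqP; rewrite eqz_mod_dvd => H.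
have := rpredB (rpredD H modhom_nil) (modhom_wpow w k).
by congr (_ %| _)%Z; lia.
Qed.

End Characters.

Lemma expsum_torsion v w k : wpow w k ~ [::] -> (o v %| k%:Z * expsum v w)%Z.
Proof.
apply: modhom_torsion => [a b|a b]; first exact: expsum_weq.
by rewrite expsum_cat.
Qed.

(** * Elements of finite order and two nonadjacent vertices *)

Section Torsion.
Variables v0 v1 : V.
Hypotheses (v01 : v0 != v1) (ne01 : ~~ e v0 v1) (ne10 : ~~ e v1 v0).
Hypotheses (o0_gt1 : (1 < o v0)%N) (o1_gt1 : (1 < o v1)%N).

Definition factor_vertex (c : bool) := if c then v0 else v1.
Definition factor u :=
  if u == v0 then Some true else if u == v1 then Some false else None.

Let M c := o (factor_vertex c).
Let M_gt1 c : (1 < M c)%N. Proof. by case: c. Qed.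

Lemma factorE u c : (factor u == Some c) = (u == factor_vertex c).
Proof.
rewrite /factor; case: c => /=; have [uv0|_] := eqVneq u v0;
  by rewrite ?uv0 ?eqxx ?(negPf v01) //; case: (u == v1).
Qed.

(* The retraction of the graph product onto the free product of the vertex
   groups at [v0] and [v1], which kills all other vertices. *)
Definition retract_letter (x : V * bool) : syllables :=
  if factor x.1 is Some c then [:: (c, if x.2 then 1%N else (M c).-1)]
  else [::].
Definition retract w : syllables := flatten (map retract_letter w).

Lemma retract_cat a b : retract (a ++ b) = retract a ++ retract b.
Proof. by rewrite /retract map_cat flatten_cat. Qed.

Lemma retract_cons x w : retract (x :: w) = retract_letter x ++ retract w.
Proof. by []. Qed.

Lemma retract_wpow w n : retract (wpow w n) = spow (retract w) n.
Proof. by elim: n => //= n IH; rewrite /wpow /= retract_cat IH. Qed.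

Lemma act_retract_weq a b x : a ~ b -> normal_form M x ->
  act M (retract a) x = act M (retract b) x.
Proof.
move=> ab; elim: ab x => [l c d r cd|w|w1 w2 _ IH|w1 w2 w3 _ IH1 _ IH2] x nx //.
- rewrite !retract_cat !act_cat; congr (act _ _ _).
  have := normal_act M_gt1 (retract r) nx; move: (act _ _ x) => {nx}x nx.
  case: cd => [u b0|u|u u' b0 c0 euu'].
  + rewrite /retract /= /retract_letter /=.
    case: (factor u) => //= i; rewrite push_push // push_dvd //.
    (* The inverse letter has exponent [(M i).-1], so the two exponents add up to [M i]. *)
    by case: b0 => /=; rewrite ?addn1 ?add1n prednK // ltnW.
  + have [i iu|nu] := pickP (fun i => factor u == Some i); last first.
      elim: (o u) => //= n; rewrite retract_cons /retract_letter /=.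
      by case: (factor u) nu => // i nu; have := nu i; rewrite eqxx.
    have act_nseq n : act M (retract (nseq n (u, true))) x = push M i n x.
      elim: n => [|n]; first by rewrite push_dvd.
      rewrite [nseq _ _]/= retract_cons /retract_letter /= (eqP iu) /= => ->.
      by rewrite push_push.
    rewrite act_nseq push_dvd //.
    by move: iu; rewrite factorE => /eqP ->.
  + rewrite /retract /= /retract_letter /=.
    case Eu: (factor u) => [i|]; case Eu': (factor u') => [j|] //=.
    (* Adjacent vertices that both survive lie in one factor, because [v0] and [v1] are not
       adjacent. *)
    have -> : j = i.
      move/eqP: Eu; move/eqP: Eu' euu'; rewrite !factorE => /eqP -> /[swap] /eqP ->.
      by case: i j => [] [] //=; rewrite ?(negPf ne01) ?(negPf ne10).
    by rewrite !push_push // addnC.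
- by rewrite IH.
- by rewrite IH1 // IH2.
Qed.

Lemma expsum_retract c w :
  (expsum (factor_vertex c) w = weight c (retract w) %[mod M c])%Z.
Proof.
apply/eqP; rewrite eqz_mod_dvd.
elim: w => [|[u b] w IH]; first by rewrite /expsum /weight !big_nil.
rewrite expsum_cons -cat1s retract_cat weight_cat PoszD opprD addrACA rpredD //=.
rewrite -factorE /retract /= /retract_letter /=.
case: (factor u) => [d|]; last by rewrite /weight big_nil.
rewrite weight_cons /weight big_nil addn0 /=.
rewrite -[Some d == _]/(d == c); case: eqVneq => [->|_] //.
rewrite mul1n; case: b; first by rewrite subrr.
rewrite /sgnb; have := M_gt1 c; case: (M c) => // k _ /=.
by rewrite -opprD -PoszD add1n rpredN.
Qed.

Lemma expsum_torsion_nonadjacent w n : (0 < n)%N -> wpow w n ~ [::] ->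
  (o v0 %| expsum v0 w)%Z \/ (o v1 %| expsum v1 w)%Z.
Proof.
move=> n_gt0 wn.
have E c : (o (factor_vertex c) %| expsum (factor_vertex c) w)%Z
    = (M c %| weight c (retract w))%N.
  rewrite -[RHS]/(M c %| (weight c (retract w))%:Z)%Z.
  by apply/dvdz_mod0P/dvdz_mod0P; rewrite -expsum_retract.
have [x nx|H|H] := torsion_weight M_gt1 (s := retract w) n_gt0.
- by rewrite -retract_wpow (act_retract_weq wn nx).
- by left; rewrite (E true).
- by right; rewrite (E false).
Qed.
End Torsion.
End GraphProduct.

(** * Linear algebra and arithmetic for the blocks *)

Local Open Scope ring_scope.

(** A right inverse gives [A] full row rank, hence a nonzero maximal minor, whose expansion has a
    nonzero term. As [A] may be rectangular, the numbers of vertices of a given order need not be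
    compared first. *)
Lemma right_inverse_transversal (F : fieldType) m n (A : 'M[F]_(m, n))
    (B : 'M_(n, m)) : A *m B = 1%:M ->
  exists2 h : 'I_m -> 'I_n, injective h & forall i, A i (h i) != 0.
Proof.
move=> AB; have full : row_full A^T.
  by rewrite /row_full mxrank_tr; apply/row_freeP; exists B.
pose r := fullrankfun full.
have: \det (rowsub r A^T) != 0 by rewrite -unitfE -unitmxE fullrowsub_unit.
have [s s_nz|s0] := pickP
    (fun s : {perm 'I_m} => [forall i, rowsub r A^T i (s i) != 0]).
  (* The minor is taken in the transpose, whose rows are the columns of [A]; hence the inverse
     permutation. *)
  move=> _; exists (fun i => r ((s^-1)%g i)) => [|i].
    exact/(inj_comp (@fullrankfun_inj _ _ _ _ full))/perm_inj.
  by have := forallP s_nz ((s^-1)%g i); rewrite !mxE permKV.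
rewrite /determinant big1 ?eqxx // => s _.
have /negbT/forallPn[i] := s0 s; rewrite negbK => /eqP si0.
by rewrite (bigD1 i) //= si0 mul0r mulr0.
Qed.

(** Here [y] and [x] encode homomorphisms between cyclic groups, from order [p ^ k] to order [m] and
    back. If [p] does not divide [x], then [p ^ k] divides [m], so [m] is a higher power of [p], and
    [y], killed by [p ^ k] modulo [m], is divisible by [p]. *)
Lemma dvdz_mul_primary_orders (p k m : nat) (x y : int) :
    prime p -> (0 < k)%N -> primary_order m -> m != (p ^ k)%N ->
    ((p ^ k)%N %| m%:Z * x)%Z -> (m %| (p ^ k)%N%:Z * y)%Z -> (p %| y * x)%Z.
Proof.
move=> pp k_gt0 [q [j [pq [j_gt0 ->]]]] neq px qy.
have [|npx] := boolP (p %| x)%Z; first exact: dvdz_mull.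
apply: dvdz_mulr.
have pk_q : (p ^ k %| q ^ j)%N.
  move: px; rewrite Gauss_dvdzl //.
  by rewrite coprimezE /= coprime_pexpl // prime_coprime.
have qp : p = q.
  have : (p %| q ^ j)%N by apply: dvdn_trans pk_q; apply: dvdn_exp.
  by rewrite Euclid_dvdX // dvdn_prime2 // => /andP[/eqP].
rewrite -{}qp in neq qy pk_q *.
have kj : (k < j)%N.
  rewrite ltn_neqAle -(dvdn_Pexp2l _ _ (prime_gt1 pp)) pk_q andbT.
  by apply: contraNneq neq => ->.
have pk0 : (p ^ k)%N%:Z != 0 by rewrite eqz_nat -lt0n expn_gt0 prime_gt0.
rewrite -(dvdz_mul2l pk0); apply: dvdz_trans qy.
by rewrite -PoszM -expnSr; apply: dvdn_exp2l.
Qed.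

(** * Isomorphisms of graph products *)

Section Isomorphism.
Variables (V1 V2 : finType) (e1 : rel V1) (o1 : V1 -> nat).
Variables (e2 : rel V2) (o2 : V2 -> nat).
Variables (f : word V1 -> word V2) (g : word V2 -> word V1).
Hypothesis f_weq : forall a b, weq e1 o1 a b -> weq e2 o2 (f a) (f b).
Hypothesis fM : forall a b, weq e2 o2 (f (a ++ b)) (f a ++ f b).
Hypothesis g_weq : forall a b, weq e2 o2 a b -> weq e1 o1 (g a) (g b).
Hypothesis gM : forall a b, weq e1 o1 (g (a ++ b)) (g a ++ g b).
Hypothesis fK : forall a, weq e1 o1 (g (f a)) a.
Hypothesis o1_primary : forall v, primary_order (o1 v).
Hypothesis o2_primary : forall v, primary_order (o2 v).

Let primary_gt1 n : primary_order n -> (1 < n)%N.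
Proof.
by case=> p [k [pp [k_gt0 ->]]]; rewrite -(exp1n k) ltn_exp2r ?prime_gt1.
Qed.

Lemma hom_nil : weq e2 o2 (f [::]) [::].
Proof. by apply: weq_idem; apply: weq_sym; apply: fM [::] [::]. Qed.

Lemma hom_wpow w n : weq e2 o2 (wpow (f w) n) (f (wpow w n)).
Proof.
elim: n => [|n IH]; first exact/weq_sym/hom_nil.
rewrite /wpow /= -!/(wpow _ _); apply: weq_trans (weq_sym (fM _ _)).
by apply: weq_cat => //; apply: weq_refl.
Qed.

Lemma hom_torsion w n : weq e1 o1 (wpow w n) [::] ->
  weq e2 o2 (wpow (f w) n) [::].
Proof.
move=> wn; apply: weq_trans (hom_wpow w n) _.
exact: weq_trans (f_weq wn) hom_nil.
Qed.

(** The matrices of the maps induced by [f] and [g] on abelianizations; [mat v u] has a meaning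
    modulo [o2 v], and [inv u v] modulo [o1 u]. *)
Let mat v u := expsum v (f [:: (u, true)]).
Let inv u v := expsum u (g [:: (v, true)]).

Let g_expsum_weq u a b :
  weq e2 o2 a b -> (expsum u (g a) = expsum u (g b) %[mod o1 u])%Z.
Proof. by move=> /g_weq; apply: expsum_weq. Qed.

Let g_expsumM u a b :
  (expsum u (g (a ++ b)) = expsum u (g a) + expsum u (g b) %[mod o1 u])%Z.
Proof. by rewrite (expsum_weq u (gM a b)) expsum_cat. Qed.

(* Modulo [p], coordinates at vertices whose group has another order contribute
   nothing, so the blocks of fixed order are inverse to each other. *)
Lemma block_mul p k u u' : prime p -> (0 < k)%N -> o1 u = (p ^ k)%N ->
  o1 u' = (p ^ k)%N ->
  (p %| \sum_(v | o2 v == (p ^ k)%N) mat v u * inv u' v - (u == u')%:R)%Z.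
Proof.
move=> pp k_gt0 ou ou'.
have p_pk (x : int) : ((p ^ k)%N %| x)%Z -> (p %| x)%Z.
  by apply: dvdz_trans; apply: (dvdn_exp k_gt0 (dvdnn p)).
have := modhom_expsum (@g_expsum_weq u') (@g_expsumM u') (f [:: (u, true)]).
rewrite ou' => /p_pk H1.
have := expsum_weq u' (fK [:: (u, true)]).
move/eqP; rewrite eqz_mod_dvd ou' expsum1 => /p_pk H2.
have H3 : (p %| \sum_(v | o2 v != (p ^ k)%N) mat v u * inv u' v)%Z.
  apply: rpred_sum => v ov.
  apply: (dvdz_mul_primary_orders pp k_gt0 (o2_primary v) ov).
    rewrite -ou'; apply: (modhom_torsion (@g_expsum_weq u') (@g_expsumM u')).
    exact: weq_order.
  rewrite -ou; apply: (@expsum_torsion _ e2).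
  by apply: hom_torsion; apply: weq_order.
move: H1 H3; rewrite (bigID (fun v => o2 v == (p ^ k)%N)) /=.
set S := (X in (_ - (X + _))); set S' := (X in (_ - (_ + X))) => H1 H3.
rewrite -[X in X - _]/S; have H4 : (p %| S')%Z := H3.
have := rpredB (rpredB H2 H1) H4.
by congr (_ %| _)%Z; lia.
Qed.

Lemma order_matching (v0 : V2) n : primary_order n ->
  exists h : V1 -> V2, [/\ {in [pred u | o1 u == n] &, injective h},
    forall u, o1 u = n -> o2 (h u) = n
  & forall u, o1 u = n -> ~~ (n %| mat (h u) u)%Z].
Proof.
case=> p [k [pp [k_gt0 ->]]]; set n0 := (p ^ k)%N.
have chp := pchar_Fp pp.
pose S1 := [pred u | o1 u == n0]; pose S2 := [pred v | o2 v == n0].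
(* If no vertex has order [n0], the conditions are vacuous and [v0] is a default value; otherwise
   [u0] is the default for [enum_rank_in]. *)
have [u0 S1u0|S1_0] := pickP S1; last first.
  have S1n u : o1 u <> n0 by move/eqP; have := S1_0 u => /= ->.
  by exists (fun=> v0); split=> [u u'|u /S1n|u /S1n] //; rewrite inE => /eqP/S1n.
pose A := \matrix_(i < #|S1|, j < #|S2|)
  ((mat (enum_val j) (enum_val i))%:~R : 'F_p).
pose B := \matrix_(j < #|S2|, i < #|S1|)
  ((inv (enum_val i) (enum_val j))%:~R : 'F_p).
have AB : A *m B = 1%:M.
  apply/matrixP => i i'; rewrite !mxE.
  have oi (l : 'I_#|S1|) : o1 (enum_val l) = n0 by apply/eqP/(enum_valP l).
  have := block_mul pp k_gt0 (oi i) (oi i').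
  rewrite (dvdz_pcharf chp) rmorphB rmorph_sum /= subr_eq0 => /eqP.
  rewrite (inj_eq enum_val_inj) => E.
  transitivity (((i == i')%:R : int)%:~R : 'F_p); last by case: (i == i').
  rewrite -{}E [RHS](eq_bigl [in S2]) // [RHS]big_enum_val /=.
  by apply: eq_bigr => j _; rewrite !mxE rmorphM.
have [h h_inj h_nz] := right_inverse_transversal AB.
pose t u := enum_val (h (enum_rank_in S1u0 u)).
have o2t u : o2 (t u) = n0 by apply/eqP; apply: (enum_valP (h _)).
exists t; split=> [u u' uS u'S /enum_val_inj/h_inj E|//|u uS].
  by rewrite -(enum_rankK_in S1u0 uS) E enum_rankK_in.
have := h_nz (enum_rank_in S1u0 u).
rewrite mxE enum_rankK_in ?inE ?uS //; rewrite -(dvdz_pcharf chp).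
by apply: contraNN; apply: dvdz_trans; apply: (dvdn_exp k_gt0 (dvdnn p)).
Qed.

Lemma matching (v0 : V2) : exists h : V1 -> V2, [/\ injective h,
    forall u, o2 (h u) = o1 u & forall u, ~~ (o2 (h u) %| mat (h u) u)%Z].
Proof.
have [H HP] := fin_all_exists (fun u => order_matching v0 (o1_primary u)).
(* The chosen [H u] may differ between vertices of equal order; one representative per order makes
   them share a matching. *)
pose rep u := odflt u [pick u' | o1 u' == o1 u].
have o_rep u : o1 (rep u) = o1 u.
  by rewrite /rep; case: pickP => [u' /eqP|].
have rep_eq u u' : o1 u = o1 u' -> rep u = rep u'.
  by rewrite /rep => ->; case: pickP => // /(_ u'); rewrite eqxx.
have o2H u : o2 (H (rep u) u) = o1 u.
  by rewrite -[RHS]o_rep; have [_ + _] := HP (rep u); apply; rewrite o_rep.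
exists (fun u => H (rep u) u); split=> // [u u' E|u]; last first.
  rewrite o2H -{1}(o_rep u); have [_ _] := HP (rep u); apply; rewrite o_rep //.
have ouu' : o1 u = o1 u' by rewrite -!o2H E.
rewrite (rep_eq u u' ouu') in E; have [+ _ _] := HP (rep u'); apply=> //.
  by rewrite inE o_rep ouu'.
by rewrite inE o_rep.
Qed.

Lemma matching_adjacent (h : V1 -> V2) : irreflexive e1 -> symmetric e2 ->
  injective h -> (forall u, ~~ (o2 (h u) %| mat (h u) u)%Z) ->
  forall u u', e1 u u' -> e2 (h u) (h u').
Proof.
move=> irr sym h_inj h_nz u u' euu'; apply: contraT => ne.
have huu' : h u != h u' by apply: contraTneq euu' => /h_inj ->; rewrite irr.
have ne' : ~~ e2 (h u') (h u) by rewrite sym.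
have o_gt0 w : (0 < o1 w)%N by apply/ltnW/primary_gt1.
have tors w n : (0 < n)%N -> weq e2 o2 (wpow w n) [::] ->
    (o2 (h u) %| expsum (h u) w)%Z \/ (o2 (h u') %| expsum (h u') w)%Z.
  by apply: expsum_torsion_nonadjacent; rewrite ?primary_gt1.
have tor1 w := hom_torsion (weq_order e1 o1 w).
(* The image of [u] is nonzero at [h u], so it vanishes at [h u']; symmetrically for [u']. *)
have [H|u'0] := tors _ _ (o_gt0 u) (tor1 u); first by have := h_nz u; rewrite H.
have [u0|H] := tors _ _ (o_gt0 u') (tor1 u'); last by have := h_nz u'; rewrite H.
have comm : weq e1 o1 ([:: (u, true)] ++ [:: (u', true)])
    ([:: (u', true)] ++ [:: (u, true)]).
  exact: (weq_step [::] [::] (wrel_comm o1 true true euu')).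
have: weq e1 o1 (wpow ([:: (u, true)] ++ [:: (u', true)]) (o1 u * o1 u')) [::].
  apply: weq_trans (weq_wpow_cat _ comm) _.
  apply: (@weq_cat _ _ _ _ [::] _ [::]).
    by apply: weq_wpow_nil; apply: weq_order.
  by rewrite mulnC; apply: weq_wpow_nil; apply: weq_order.
move/hom_torsion/tors; rewrite muln_gt0 !o_gt0 => /(_ isT).
have fuu' v : (o2 v %| expsum v (f ([:: (u, true)] ++ [:: (u', true)])))%Z =
    (o2 v %| mat v u + mat v u')%Z.
  by apply/dvdz_mod0P/dvdz_mod0P; rewrite (expsum_weq v (fM _ _)) expsum_cat.
(* The image of the product thus has nonzero coordinates at both [h u] and [h u'], against its
   finite order. *)
rewrite !fuu' (rpredDr _ u0) (rpredDl _ u'0).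
by case=> H; [have := h_nz u | have := h_nz u']; rewrite H.
Qed.

End Isomorphism.

Theorem theorem4p4 (V1 V2 : finType) (e1 : rel V1) (o1 : V1 -> nat)
    (e2 : rel V2) (o2 : V2 -> nat) :
  primary_labeled_graph e1 o1 -> primary_labeled_graph e2 o2 ->
  forall tau : word V1 -> word V2, graph_product_iso e1 o1 e2 o2 tau ->
  exists t : V1 -> V2, labeled_graph_iso e1 o1 e2 o2 t /\
    forall u : V1, csupp e2 o2 (tau [:: (u, true)]) (t u).
Proof.
move=> [/card_gt0P[v1 _] irr1 sym1 pr1] [/card_gt0P[v2 _] irr2 sym2 pr2] f.
move=> [f_weq fM [g [g_weq fK gK]]].
(* The inverse is multiplicative because [f] is: apply [g] to the product law of [f] at [g a] and
   [g b]. *)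
have gM a b : weq e1 o1 (g (a ++ b)) (g a ++ g b).
  apply: weq_trans (fK _); apply: g_weq.
  apply: weq_sym; apply: weq_trans (fM _ _) _.
  by apply: weq_cat; apply: gK.
have [t [t_inj t_o t_nz]] := matching f_weq fM g_weq gM fK pr1 pr2 v2.
have [s [s_inj s_o s_nz]] := matching g_weq gM f_weq fM gK pr2 pr1 v1.
have t_adj := matching_adjacent f_weq fM pr1 pr2 irr1 sym2 t_inj t_nz.
have s_adj := matching_adjacent g_weq gM pr2 pr1 irr2 sym1 s_inj s_nz.
exists t; split=> [|u]; last exact: csupp_expsum.
split=> // [|u u'].
  by apply: inj_card_bij => //; apply: leq_card s_inj.
apply/idP/idP => [|tuu']; first exact: t_adj.
(* Edges are counted as ordered pairs: [tt] and [ss] embed [E1] and [E2] into each other, so [tt]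
   maps [E1] onto [E2] and, being injective, reflects adjacency. *)
pose E1 := [set x | e1 x.1 x.2]; pose E2 := [set x | e2 x.1 x.2].
pose tt x := (t x.1, t x.2); pose ss x := (s x.1, s x.2).
have tt_inj : injective tt by move=> [a b] [c d] [/t_inj -> /t_inj ->].
have ss_inj : injective ss by move=> [a b] [c d] [/s_inj -> /s_inj ->].
have ttE : tt @: E1 \subset E2.
  by apply/subsetP => _ /imsetP[x + ->]; rewrite !inE; apply: t_adj.
have ssE : ss @: E2 \subset E1.
  by apply/subsetP => _ /imsetP[x + ->]; rewrite !inE; apply: s_adj.
have ttE1 : tt @: E1 = E2.
  apply/eqP; rewrite eqEcard ttE card_imset // -(card_imset _ ss_inj).
  exact: subset_leq_card.
have : tt (u, u') \in tt @: E1 by rewrite ttE1 inE.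
by rewrite mem_imset // inE.
Qed.
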